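(* For $l\ge1$, \[t(1-t)f_{A_l}(t)=\frac{1}{(l+1)!}\frac{d^l}{dt^l}\big[t^{l+1}(1-t)^{l+1}\big];\] for $l\ge2$, \[f_{B_l}(t)=\frac{1}{l!}\frac{d^l}{dt^l}\big[t^l(1-t)^l\big];\] and for $l\ge4$, \[f_{D_l}(t)=\frac{1}{(l-1)!}\frac{d^{l-1}}{dt^{l-1}}\big[t^{l-1}(1-t)^l\big]+\frac{1}{(l-2)!}\frac{d^{l-2}}{dt^{l-2}}\big[t^l(1-t)^{l-2}\big]=\frac{1}{(l-1)!}\frac{d^{l-2}}{dt^{l-2}}\Big[t^{l-2}(1-t)^{l-2}\big\{(l-1)-(3l-2)t+(3l-2)t^2\big\}\Big].\]
   Context: Here $f_{A_l}(t)=\sum_{k=0}^l(-1)^k\frac{1}{l+2}\binom{l}{k}\binom{l+k+2}{k+1}t^k$, $f_{B_l}(t)=\sum_{k=0}^l(-1)^k\binom lk\binom{l+k}{k}t^k$, $f_{D_l}(t)=\sum_{k=0}^l(-1)^k\big(\binom lk\binom{l+k-1}{k}+\binom{l-2}{k-2}\binom{l+k-2}{k}\big)t^k$ (with $\binom nm=0$ for $m<0$); these are the $f$-polynomials (face generating functions $\sum_i c_i(-t)^i$, $c_i$ = number of $i$-vertex faces) of the Fomin–Zelevinsky cluster complexes of types $A_l,B_l,D_l$. *)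

(* Defs.v *)
From mathcomp Require Import all_boot all_order all_algebra.

Set Implicit Arguments.
Unset Strict Implicit.
Unset Printing Implicit Defensive.

Import Order.TTheory GRing.Theory Num.Theory.
Local Open Scope ring_scope.

(* The binomial coefficient with an integer lower index, zero when that index
   is negative.  It keeps the index k - 2 in type D out of the truncated
   subtraction of nat, which would read k - 2 as 0 for k < 2. *)
Definition binz (n : nat) (m : int) : nat :=
  if m is Posz k then 'C(n, k) else 0%N.

Definition fA (R : numFieldType) (l : nat) : {poly R} :=
  \sum_(0 <= k < l.+1)
    ((-1) ^+ k * (l%:R + 2)^-1 * ('C(l, k))%:R * ('C(l + k + 2, k + 1))%:R)
      *: 'X^k.

Definition fB (R : numFieldType) (l : nat) : {poly R} :=
  \sum_(0 <= k < l.+1)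
    ((-1) ^+ k * ('C(l, k))%:R * ('C(l + k, k))%:R) *: 'X^k.

(* The upper indices l + k - 1, l - 2 and l + k - 2 use truncated subtraction,
   which is exact for l >= 2. *)
Definition fD (R : numFieldType) (l : nat) : {poly R} :=
  \sum_(0 <= k < l.+1)
    ((-1) ^+ k *
       (('C(l, k))%:R * ('C(l + k - 1, k))%:R
        + (binz (l - 2) (k%:Z - 2))%:R * ('C(l + k - 2, k))%:R))
      *: 'X^k.

(* Main.v *)
(* Both sides are compared coefficientwise: dividing by d! turns the
   d-th derivative into the Hasse derivative, whose coefficients on
   t^(d+e) (1-t)^n are signed products of two binomials.  Type A reduces to a
   quadratic relation between binomials, and the last form in type D comes
   from carrying out one of the l - 1 derivatives of t^(l-1) (1-t)^l. *)
Require Import Defs.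
From mathcomp Require Import all_boot all_order all_algebra ring zify.

Import Order.TTheory GRing.Theory Num.Theory.
Local Open Scope ring_scope.

Lemma inv_fact_derivn (R : numFieldType) (d : nat) (p : {poly R}) :
  (d`!%:R)^-1 *: p^`(d) = p^`N(d).
Proof.
rewrite nderivn_def -scaler_nat scalerA mulVf ?scale1r //.
by rewrite pnatr_eq0 -lt0n fact_gt0.
Qed.

Lemma coef_exp_1subX (R : nzRingType) (n i : nat) :
  ((1 - 'X) ^+ n : {poly R})`_i = (-1) ^+ i * ('C(n, i))%:R.
Proof.
have -> : (1 - 'X) ^+ n = \poly_(j < n.+1) ((-1) ^+ j * ('C(n, j))%:R : R).
  (* [R] may be noncommutative, so the binomial theorem is applied to the commuting pair [1],
     ['X]. *)
  rewrite exprBn_comm; last exact: commr_sym (commr1 _).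
  rewrite poly_def; apply: eq_bigr => j _.
  rewrite expr1n mulr1 -mul_polyC rmorphM /= rmorph_sign rmorph_nat.
  by rewrite -mulrA mulr_natl mulrnAr.
rewrite coef_poly ltnS; case: leqP => // lt_ni.
by rewrite bin_small // mulr0.
Qed.

(** The exponent is split as [d + e] because [e] is the order of vanishing at 0 left after [d]
    derivatives: [e] is 1 in type A, 0 in type B, and 0 and 2 for the two terms of type D. *)
Lemma coef_nderivn_XnM1subX (R : nzRingType) (d e n i : nat) :
  (('X^(d + e) * (1 - 'X) ^+ n)^`N(d) : {poly R})`_i
  = if (i < e)%N then 0
    else (-1) ^+ (i - e) * ('C(n, i - e))%:R * ('C(d + i, d))%:R.
Proof.
rewrite coef_nderivn coefXnM ltn_add2l; case: ifP => _; first by rewrite mul0rn.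
by rewrite subnDl coef_exp_1subX [RHS]mulr_natr.
Qed.

Lemma coef_sum_scaleXn (R : nzRingType) (l : nat) (c : nat -> R) (i : nat) :
  ((l < i)%N -> c i = 0) -> (\sum_(0 <= k < l.+1) c k *: 'X^k)`_i = c i.
Proof.
move=> c0; rewrite big_mkord -poly_def coef_poly ltnS.
by case: leqP => // /c0.
Qed.

Lemma coef_fA (R : numFieldType) (l i : nat) :
  (fA R l)`_i
  = (-1) ^+ i * (l%:R + 2)^-1 * ('C(l, i))%:R * ('C(l + i + 2, i + 1))%:R.
Proof. by apply: coef_sum_scaleXn => li; rewrite bin_small // mulr0 mul0r. Qed.

Lemma coef_fB (R : numFieldType) (l i : nat) :
  (fB R l)`_i = (-1) ^+ i * ('C(l, i))%:R * ('C(l + i, i))%:R.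
Proof. by apply: coef_sum_scaleXn => li; rewrite bin_small // mulr0 mul0r. Qed.

Lemma binz_subn (n k m : nat) :
  binz n (k%:Z - m%:Z) = if (k < m)%N then 0%N else 'C(n, k - m).
Proof.
case: ltnP => [lt_km|le_mk]; last by rewrite subzn.
by rewrite -opprB subzn 1?ltnW // -(subnSK lt_km) -NegzE.
Qed.

Lemma coef_fD (R : numFieldType) (l i : nat) :
  (fD R l)`_i
  = (-1) ^+ i *
     (('C(l, i))%:R * ('C(l + i - 1, i))%:R
      + (if (i < 2)%N then 0%N else 'C(l - 2, i - 2))%:R
        * ('C(l + i - 2, i))%:R).
Proof.
rewrite -binz_subn; apply: coef_sum_scaleXn => li.
rewrite bin_small // mul0r add0r (binz_subn _ _ 2).
case: ltnP => [_|i2]; first by rewrite mul0r mulr0.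
(* For [l < 2] the truncated [l - 2] is 0 and ['C(0, i - 2)] can be 1; the other factor then
   vanishes, since [l + i - 2 < i]. *)
case: (ltnP l 2) => l2; last by rewrite bin_small ?mul0r ?mulr0 //; lia.
by rewrite [X in _ * (_ * X%:R)]bin_small ?mulr0 //; lia.
Qed.

(** This is the type A identity at [t^(j+2)], with sign and denominators cleared. Times
    [(j+1)(j+2)], both sides become multiples of ['C(l, j) * 'C(l + j + 2, j.+1)], and what remains
    is [(l-j)(l+j+3) + (j+1)(j+2) = (l+1)(l+2)]. *)
Lemma bin_typeA (l j : nat) :
  (l.+1 * ('C(l, j.+1) * 'C(l + j + 3, j.+2) + 'C(l, j) * 'C(l + j + 2, j.+1))
   = l.+2 * ('C(l.+1, j.+1) * 'C(l + j + 2, j.+2)))%N.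
Proof.
case: (leqP j l) => [le_jl|lt_lj]; last first.
  by rewrite !(@bin_small l) ?(@bin_small l.+1) ?muln0 //; lia.
have e1 := mul_bin_left l j.
have e2 := mul_bin_diag l.+1 j.
have e3 : (j.+2 * 'C(l + j + 2, j.+2) = l.+1 * 'C(l + j + 2, j.+1))%N.
  by rewrite mul_bin_left; congr (_ * _)%N; lia.
have e4 : (j.+2 * 'C(l + j + 3, j.+2) = (l + j + 3) * 'C(l + j + 2, j.+1))%N.
  by rewrite -mul_bin_diag !addnS.
apply/eqP; rewrite -(@eqn_pmul2l (j.+1 * j.+2)) //; apply/eqP.
set a := 'C(l, j) in e1 e2 *; set b := 'C(l + j + 2, j.+1) in e3 e4 *.
transitivity (l.+1 * ((j.+1 * 'C(l, j.+1)) * (j.+2 * 'C(l + j + 3, j.+2))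
              + j.+1 * j.+2 * (a * b)))%N; first by ring.
transitivity (l.+2 * ((j.+1 * 'C(l.+1, j.+1)) * (j.+2 * 'C(l + j + 2, j.+2))))%N;
  last by ring.
(* Writing [l = j + m] removes the truncated [l - j] before [ring]. *)
rewrite e1 e3 e4 -e2 /= -/a; have [m ->] : exists m, l = (j + m)%N.
  by exists (l - j)%N; rewrite subnKC.
by rewrite addKn; ring.
Qed.

Lemma inv_factS_derivn (R : numFieldType) (l : nat) (p : {poly R}) :
  (l.+1`!%:R)^-1 *: p^`(l) = l.+1%:R^-1 *: p^`N(l).
Proof. by rewrite factS natrM invfM -scalerA inv_fact_derivn. Qed.

Lemma fA_derivn (R : numFieldType) (l : nat) :
  'X * (1 - 'X) * fA R l
  = ((l.+1)`!%:R)^-1 *: ('X^(l.+1) * (1 - 'X) ^+ l.+1)^`(l).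
Proof.
rewrite inv_factS_derivn -addn1; apply/polyP => i.
rewrite coefZ coef_nderivn_XnM1subX -mulrA coefXM.
case: i => [|i]; first by rewrite mulr0.
rewrite ltnS ltn0 subn1 /= mulrBl mul1r coefB coefXM !coef_fA.
have n1 : (l.+1%:R : R) != 0 by rewrite pnatr_eq0.
have n2 : (l%:R + 2 : R) != 0 by rewrite -natrD pnatr_eq0; lia.
(* The coefficient of [t] has no shifted term; both sides equal 1 there. *)
case: i => [|j] /=.
  rewrite !bin0 !addn0 !add0n !addn1 bin1 subr0 expr0 !mul1r mulr1 addn2.
  by rewrite binSn [RHS]mulVf // -(addn2 l) natrD mulVf.
have := congr1 (fun n => n%:R : R) (bin_typeA l j).
rewrite !natrM natrD !natrM !addn1.
rewrite (_ : l + j.+1 + 2 = l + j + 3)%N; last by lia.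
rewrite (_ : l + j.+2 = l + j + 2)%N; last by lia.
rewrite -(bin_sub (_ : l <= l + j + 2)%N); last by lia.
rewrite (_ : l + j + 2 - l = j.+2)%N; last by lia.
rewrite exprS -(addn2 l) natrD.
set x1 := 'C(l, j.+1)%:R; set x2 := 'C(l + j + 3, _)%:R.
set x3 := 'C(l, j)%:R; set x4 := 'C(l + j + 2, j.+1)%:R.
set y1 := 'C(l.+1, _)%:R; set y2 := 'C(l + j + 2, _)%:R => E.
set s := (-1) ^+ j; apply: (mulfI n1); apply: (mulfI n2).
transitivity (- s * (l.+1%:R * (x1 * x2 + x3 * x4))); first by field.
by rewrite E; field; rewrite nat1r.
Qed.

Lemma fB_derivn (R : numFieldType) (l : nat) :
  fB R l = (l`!%:R)^-1 *: ('X^l * (1 - 'X) ^+ l)^`(l).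
Proof.
rewrite inv_fact_derivn -[X in 'X^X]addn0; apply/polyP => i.
rewrite coef_nderivn_XnM1subX coef_fB subn0.
by rewrite -(@bin_sub (l + i) l) ?leq_addr // addKn.
Qed.

(** With [l = m + 2], the two products in each coefficient of [fD] match the two derivatives one by
    one. *)
Lemma fD_derivn (R : numFieldType) (m : nat) :
  fD R m.+2
  = (m.+1`!%:R)^-1 *: ('X^(m.+1) * (1 - 'X) ^+ m.+2)^`(m.+1)
    + (m`!%:R)^-1 *: ('X^(m.+2) * (1 - 'X) ^+ m)^`(m).
Proof.
rewrite !inv_fact_derivn -[X in 'X^X * _ ^+ m.+2]addn0.
rewrite -[X in 'X^X * _ ^+ m]addn2; apply/polyP => i.
rewrite coefD !coef_nderivn_XnM1subX coef_fD subn0 mulrDr mulrA /=.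
rewrite -(@bin_sub (m.+1 + i) m.+1) ?leq_addr // addKn subn1 addSn /=.
congr (_ + _); rewrite !addSn !subSS !subn0.
case: ltnP => [_|i2]; first by rewrite mul0r mulr0.
rewrite -(@bin_sub (m + i) m) ?leq_addr // addKn mulrA.
(* The shift by 2 keeps the parity, hence the sign. *)
by rewrite -(signr_odd _ (i - 2)) oddB // addbF signr_odd.
Qed.

Lemma typeD_derivn_closed (R : numFieldType) (m : nat) :
  (m.+1`!%:R : R)^-1 *: ('X^(m.+1) * (1 - 'X) ^+ m.+2)^`(m.+1)
  + (m`!%:R : R)^-1 *: ('X^(m.+2) * (1 - 'X) ^+ m)^`(m)
  = (m.+1`!%:R : R)^-1 *:
      ('X^m * (1 - 'X) ^+ m
       * ((m.+2%:R - 1)%:P - (3 * m.+2%:R - 2) *: 'X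
          + (3 * m.+2%:R - 2) *: 'X^2))^`(m).
Proof.
have m1 : (m.+1%:R : R) != 0 by rewrite pnatr_eq0.
(* Both terms are put over the common factor [1/(m+1)!]. *)
rewrite (_ : (m`!%:R)^-1 = (m.+1`!%:R)^-1 * m.+1%:R :> R); last first.
  by rewrite factS natrM invfM mulrAC mulVf // mul1r.
rewrite -scalerA -scalerDr; congr (_ *: _).
(* The innermost derivative is peeled off, so all terms are [m]-th derivatives. After removing
   [t^m (1-t)^m], the identity left is [(m+1)(1-t)^2 - (m+2)t(1-t) + (m+1)t^2 = (m+1) - (3m+4)t +
   (3m+4)t^2]. *)
rewrite /derivn iterSr -!/(derivn _ _) -derivnZ -derivnD; congr (_^`(_)).
rewrite derivM derivXn deriv_exp derivB derivX derivC /=.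
rewrite -!mul_polyC !polyCB !polyCM !polyC_natr polyC1 !exprS expr0 mulr1.
rewrite -[_ *+ m.+1]mulr_natr -[_ *+ m.+2]mulr_natr.
set u := 'X^m; set v := (1 - 'X) ^+ m.
rewrite -[m.+2]addn1 -[m.+1]addn1 !natrD.
by ring.
Qed.

Theorem theorem2p2 (R : numFieldType) :
  (forall l : nat, (1 <= l)%N ->
     'X * (1 - 'X) * fA R l
     = ((l.+1)`!%:R)^-1 *: ('X^(l.+1) * (1 - 'X) ^+ l.+1)^`(l))
  /\
  (forall l : nat, (2 <= l)%N ->
     fB R l = (l`!%:R)^-1 *: ('X^l * (1 - 'X) ^+ l)^`(l))
  /\
  (forall l : nat, (4 <= l)%N ->
     fD R l
     = ((l - 1)`!%:R : R)^-1 *: ('X^(l - 1) * (1 - 'X) ^+ l)^`(l - 1)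
       + ((l - 2)`!%:R : R)^-1 *: ('X^l * (1 - 'X) ^+ (l - 2))^`(l - 2)
     /\
     ((l - 1)`!%:R : R)^-1 *: ('X^(l - 1) * (1 - 'X) ^+ l)^`(l - 1)
       + ((l - 2)`!%:R : R)^-1 *: ('X^l * (1 - 'X) ^+ (l - 2))^`(l - 2)
     = ((l - 1)`!%:R : R)^-1 *:
         ('X^(l - 2) * (1 - 'X) ^+ (l - 2)
          * ((l%:R - 1)%:P - (3 * l%:R - 2) *: 'X + (3 * l%:R - 2) *: 'X^2)
         )^`(l - 2)).
Proof.
split; first by move=> l _; exact: fA_derivn.
split; first by move=> l _; exact: fB_derivn.
move=> [|[|m]] // _; rewrite !subSS !subn0.
by split; [exact: fD_derivn | exact: typeD_derivn_closed].
Qed.
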